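(* Let $n\in\mathbb{N}$ and suppose that a real polynomial $$P(x)=a_0+a_1x+a_2\frac{x(x-1)}{2!}+\ldots+a_n\frac{x(x-1)\cdots(x-n+1)}{n!},\qquad a_n=1,$$ is such that $(P(k))_{k=0}^\infty\in\mathrm{TP}$. Let $Q(x)=a_0+a_1x+a_2x^2+\ldots+a_nx^n$. Then: 1. If there exists $k\in\{1,2,\ldots,n-1\}$ such that $P(k)=0$, then $P(0)=P(1)=\ldots=P(k-1)=0$. 2. For every $m\in\mathbb{N}$, $$P(-m)=\frac{1}{(m-1)!}\left(x^{m-1}Q(x)\right)^{(m-1)}\Big|_{x=-1},$$ where the superscript $(m-1)$ denotes the $(m-1)$-th derivative with respect to $x$. 3. If there exists $l\in\mathbb{N}$ such that $P(-l)=0$, then $P(-1)=P(-2)=\ldots=P(-(l-1))=0$. 4. If $\deg P=2l+1$ for some $l\in\mathbb{N}\cup\{0\}$, then there is a root of $P$ in the segment $[-1,0]$.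
   Context: A sequence of nonnegative real numbers $(b_k)_{k=0}^\infty$ is called totally positive if all minors of the infinite upper triangular Toeplitz matrix $\left(b_{j-i}\right)_{i,j=0}^{\infty}$ (with the convention $b_k=0$ for $k<0$) are nonnegative. $\mathrm{TP}$ denotes the set of all totally positive sequences. $\mathbb{N}=\{1,2,3,\dots\}$. Every real polynomial $P$ of degree $n$ is uniquely written in the displayed form, with real coefficients $a_0,\dots,a_n$. In part 3 the conclusion is vacuous when $l=1$. *)

(* Defs.v *)
From HB Require Import structures.
From mathcomp Require Import all_boot all_order all_algebra.
From mathcomp Require Import reals.
Set Implicit Arguments.
Unset Strict Implicit.
Unset Printing Implicit Defensive.
Import Order.TTheory GRing.Theory Num.Theory.
Local Open Scope ring_scope.

Definition toeplitz (R : realType) (b : nat -> R) (i j : nat) : R :=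
  if (i <= j)%N then b (j - i)%N else 0.

Definition toeplitz_minor (R : realType) (b : nat -> R) (r : nat)
    (rows cols : 'I_r -> nat) : R :=
  \det (\matrix_(i < r, j < r) toeplitz b (rows i) (cols j)).

Definition totally_positive (R : realType) (b : nat -> R) : Prop :=
  (forall k : nat, 0 <= b k) /\
  (forall (r : nat) (rows cols : 'I_r -> nat),
     {homo rows : i j / (i < j)%N} -> {homo cols : i j / (i < j)%N} ->
     0 <= toeplitz_minor b rows cols).

(* x (x - 1) ... (x - k + 1) / k! *)
Definition binom_poly (R : realType) (k : nat) : {poly R} :=
  (k`!%:R)^-1 *: \prod_(i < k) ('X - (i%:R)%:P).
Arguments binom_poly R k : clear implicits.

(* Main.v *)
(** Let [h_m] be the coefficients of the polynomial
    [(1 - z)^(n+1) * \sum_k P(k) z^k].  Each [h_m] is nonnegative because its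
    product with a positive [(n+1)]-minor is an [(n+2)]-minor of the Toeplitz
    matrix.  Since the [(n+1)]-st differences of [P] vanish, the [(n+1)]-st
    differences of [u_j = (-1)^n P(-j)], [j >= 1], extended by zero to [j <= 0],
    are the [h_m] in reverse order.  Summing [n] times, [u] is nonnegative and
    nondecreasing: this gives part 3, and for odd [n] the sign [P(-1) <= 0 <= P(0)]
    gives part 4.  Part 1 uses only 2 x 2 minors and the fact that [P] has
    finitely many roots, and part 2 is checked on the basis [binom_poly k]. *)
Require Import Defs.
From HB Require Import structures.
From mathcomp Require Import all_boot all_order all_algebra.
From mathcomp Require Import reals.
From mathcomp Require Import zify ring.
Set Implicit Arguments.
Unset Strict Implicit.
Unset Printing Implicit Defensive.
Import Order.TTheory GRing.Theory Num.Theory.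
Local Open Scope ring_scope.

(** * Nonvanishing determinants built from a polynomial *)

Lemma det_Vandermonde_neq0 (R : numFieldType) (n : nat) (x : 'I_n -> R) :
  injective x -> \det (Vandermonde n (\row_i x i)) != 0.
Proof.
move=> x_inj; rewrite det_Vandermonde.
apply/prodf_neq0 => i _; apply/prodf_neq0 => j lt_ij.
rewrite !mxE subr_eq0; apply/eqP => /x_inj eq_ji.
by rewrite eq_ji ltnn in lt_ij.
Qed.

(** Entries with k + l > n vanish, so reversing the rows leaves a lower triangular matrix with
    diagonal entries p_n C(n, i). *)
Lemma det_hankel_coef_neq0 (R : numFieldType) (n : nat) (p : {poly R}) :
  size p = n.+1 ->
  \det (\matrix_(k < n.+1, l < n.+1) (p`_(k + l) *+ 'C(k + l, k))) != 0.
Proof.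
move=> sz_p; set H := \matrix_(k, l) _.
pose s := perm.perm (@rev_ord_inj n.+1).
have : \det (row_perm s H) != 0.
  rewrite det_trig.
    apply/prodf_neq0 => i _; rewrite !mxE perm.permE /= subSS.
    rewrite subnK ?leq_ord // mulrn_eq0 negb_or -lt0n bin_gt0 leq_subr /=.
    by rewrite -[X in p`_X]/(n.+1.-1) -sz_p -lead_coefE lead_coef_eq0
               -size_poly_eq0 sz_p.
  apply/is_trig_mxP => i j lt_ij; rewrite !mxE perm.permE /=.
  rewrite nth_default ?mul0rn // sz_p.
  by have := ltn_ord i; have := ltn_ord j; lia.
by rewrite row_permE det_mulmx mulf_eq0 negb_or => /andP[].
Qed.

(* By Taylor's formula the matrix is a product of a Vandermonde matrix in [- y],
   a triangular-up-to-reversal coefficient matrix, and a Vandermonde matrix in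
   [x]. *)
Lemma det_horner_sub_neq0 (R : numFieldType) (n : nat) (p : {poly R})
    (x y : 'I_n.+1 -> R) :
  size p = n.+1 -> injective x -> injective y ->
  \det (\matrix_(i < n.+1, j < n.+1) p.[x j - y i]) != 0.
Proof.
move=> sz_p x_inj y_inj.
have -> : \matrix_(i < n.+1, j < n.+1) p.[x j - y i] =
    (Vandermonde n.+1 (\row_i (- y i)))^T
      *m (\matrix_(k < n.+1, l < n.+1) (p`_(k + l) *+ 'C(k + l, k)))
      *m Vandermonde n.+1 (\row_i x i).
  apply/matrixP => i j; rewrite -mulmxA !mxE.
  rewrite (@nderiv_taylor_wide _ n.+1) ?sz_p //; last exact: mulrC.
  apply: eq_bigr => k _; rewrite !mxE mulrC; congr (_ * _).
  rewrite (@horner_coef_wide _ n.+1); last first.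
    apply/leq_sizeP => m le_nm; rewrite coef_nderivn nth_default ?mul0rn //.
    by rewrite sz_p (leq_trans le_nm) ?leq_addl.
  by apply: eq_bigr => l _; rewrite !mxE coef_nderivn.
rewrite !det_mulmx det_tr !mulf_neq0 ?det_Vandermonde_neq0 //.
  by apply: (inj_comp oppr_inj).
exact: det_hankel_coef_neq0.
Qed.

(** * Finite differences and the Toeplitz minors *)

Definition alt_binom (R : realType) (d i : nat) : R := (-1) ^+ i * 'C(d, i)%:R.

(** Pascal's rule, in the form (1 - z)^(d+1) = (1 - z)^d (1 - z): [alt_binom R d i] is the
    coefficient of z^i in (1 - z)^d. *)
Lemma alt_binom_sumS (R : realType) (d : nat) (F : nat -> R) :
  \sum_(i < d.+2) alt_binom R d.+1 i * F i =
  \sum_(i < d.+1) alt_binom R d i * (F i - F i.+1).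
Proof.
under [RHS]eq_bigr do rewrite mulrBr.
rewrite sumrB big_ord_recl [X in _ = X - _]big_ord_recl /alt_binom /= !bin0.
rewrite -addrA; congr (_ + _).
rewrite [in LHS](eq_bigr (fun i : 'I_d.+1 =>
    alt_binom R d i.+1 * F i.+1 - alt_binom R d i * F i.+1)); last first.
  move=> i _; rewrite /bump add1n /alt_binom binS natrD exprS; ring.
rewrite sumrB; congr (_ - _).
by rewrite big_ord_recr /= /alt_binom bin_small // mulr0 mul0r addr0.
Qed.

(** Shifting the variable preserves the coefficient of degree [d], which therefore cancels. *)
Lemma size_sub_shift_poly (R : realType) (c : R) (d : nat) (p : {poly R}) :
  (size p <= d.+1)%N -> (size (p - (p \Po ('X + c%:P)))%R <= d)%N.
Proof.
move=> le_p.
have szX : size ('X + c%:P) = 2 by rewrite size_XaddC.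
apply/leq_sizeP => j; rewrite leq_eqVlt => /predU1P[<- | lt_dj]; last first.
  by rewrite coefB !nth_default ?subr0 ?size_comp_poly2 ?(leq_trans le_p).
rewrite coefB; have [lt_pd | le_dp] := ltnP d (size p); last first.
  by rewrite !nth_default ?subr0 ?size_comp_poly2.
have sz_p : size p = d.+1 by apply/eqP; rewrite eqn_leq le_p.
have := @lead_coef_comp _ p ('X + c%:P).
rewrite szX lead_coefXaddC expr1n mulr1 !lead_coefE size_comp_poly2 //.
by rewrite sz_p => -> //; rewrite subrr.
Qed.

(** Each difference lowers the degree by one. The general step [c] covers both directions, 1 and
    -1. *)
Lemma alt_binom_sum_horner (R : realType) (c : R) (d : nat) (p : {poly R}) (x : R) :
  (size p <= d)%N -> \sum_(i < d.+1) alt_binom R d i * p.[x + i%:R * c] = 0.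
Proof.
elim: d p => [|d IHd] p le_p.
  by rewrite big1 // => i _; move: le_p; rewrite leqn0 size_poly_eq0 => /eqP->;
     rewrite horner0 mulr0.
rewrite (alt_binom_sumS d (fun i => p.[x + i%:R * c])).
rewrite -[RHS](IHd _ (size_sub_shift_poly c le_p)); apply: eq_bigr => i _.
rewrite !hornerE horner_comp !hornerE; congr (_ * (_ - p.[_])).
by rewrite -natr1; ring.
Qed.

(* The sum is the coefficient of [z ^ m] in [(1 - z) ^ (n + 1) * \sum_k p(k) z ^ k].
   In the minor with rows [0 .. n+1] and columns [m, M+1 .. M+n+1], [M] large,
   replacing row 0 by the alternating binomial combination of all rows preserves
   the determinant and turns that row into [(h, 0, .., 0)]. *)
Lemma toeplitz_fin_diff_ge0 (R : realType) (n m : nat) (p : {poly R}) :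
  size p = n.+1 -> totally_positive (fun k => p.[k%:R]) ->
  0 <= \sum_(i < n.+2) alt_binom R n.+1 i * toeplitz (fun k => p.[k%:R]) i m.
Proof.
move=> sz_p [_ tp]; set b := fun k : nat => p.[k%:R]; set h := \sum_(i < _) _.
(* [M] exceeds [m] and every row index, so the columns stay increasing and those after the first
   avoid the zero part of the Toeplitz matrix. *)
pose M := (m + n.+2)%N.
pose cols (j : 'I_n.+2) : nat := if j == ord0 then m else (M + j)%N.
pose A := \matrix_(i < n.+2, j < n.+2) toeplitz b i (cols j).
pose K := \matrix_(i < n.+1, j < n.+1) p.[(M + j.+1)%:R - i.+1%:R].
have entryE i j : (i <= n.+1)%N -> (j <= n.+1)%N ->
    toeplitz b i (M + j) = p.[(M + j)%:R - i%:R].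
  move=> lei lej; rewrite /toeplitz /b.
  have le_i : (i <= M + j)%N by rewrite /M; lia.
  by rewrite le_i natrB.
have detK_ge0 : 0 <= \det K.
  suff -> : K = \matrix_(i, j) toeplitz b i.+1 (M + j.+1)%N.
    by apply: (tp n.+1 (fun i => i.+1) (fun j => M + j.+1)%N) => i j; rewrite ?ltn_add2l.
  by apply/matrixP => i j; rewrite !mxE entryE.
have detK_neq0 : \det K != 0.
  apply: (@det_horner_sub_neq0 _ _ _ (fun j => (M + j.+1)%:R) (fun i => i.+1%:R)) => //.
    by move=> i j /(mulrIn (oner_neq0 R)) /addnI [] /val_inj.
  by move=> i j /(mulrIn (oner_neq0 R)) [] /val_inj.
have detA_ge0 : 0 <= \det A.
  apply: (tp n.+2 (fun i => i) cols) => // i j lt_ij.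
  rewrite /cols; case: (i =P ord0) => [i0 | _]; case: (j =P ord0) => [j0 | _] //.
  - by rewrite i0 j0 in lt_ij.
  - by rewrite /M; lia.
  - by rewrite j0 in lt_ij.
  - by rewrite ltn_add2l.
(* The row operation is left multiplication by a unitriangular matrix, because [alt_binom R n.+1 0]
   is 1. *)
pose U : 'M[R]_(1 + n.+1) :=
  block_mx 1%:M (\row_(j < n.+1) alt_binom R n.+1 j.+1) 0 1%:M.
suff detA : \det A = h * \det K.
  by move: detA_ge0; rewrite detA pmulr_lge0 // lt_neqAle eq_sym detK_neq0.
have -> : \det A = \det (U *m A).
  by rewrite det_mulmx det_ublock !det1 !mul1r.
have U0 k : U ord0 k = alt_binom R n.+1 k.
  rewrite /U; have -> : ord0 = lshift n.+1 (ord0 : 'I_1) by apply: val_inj.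
  case: (split_ordP k) => j ->.
    by rewrite block_mxEul (ord1 j) mxE -[RHS]/(alt_binom R n.+1 0) /alt_binom bin0 mulr1.
  by rewrite block_mxEur mxE.
have US i k : U (lift ord0 i) k = (lift ord0 i == k)%:R.
  rewrite /U; have -> : lift ord0 i = rshift 1 i by apply: val_inj.
  case: (split_ordP k) => j ->.
    by rewrite block_mxEdl mxE -val_eqE (ord1 j).
  by rewrite block_mxEdr mxE -!val_eqE.
rewrite (expand_det_row _ ord0) big_ord_recl /= [X in _ + X]big1 ?addr0 => [|j _]; last first.
  rewrite !mxE (eq_bigr (fun k : 'I_n.+2 =>
    alt_binom R n.+1 k * p.[(M + j.+1)%:R + k%:R * -1])); last first.
    move=> k _; rewrite U0 !mxE /cols /= -[bump 0 j]/j.+1 entryE ?mulrN1 //.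
    by rewrite -ltnS.
  by rewrite alt_binom_sum_horner ?sz_p // mul0r.
congr (_ * _).
  by rewrite !mxE; apply: eq_bigr => k _; rewrite U0 !mxE.
rewrite /cofactor /= addn0 expr0 mul1r; congr (\det _).
apply/matrixP => i j; rewrite !mxE (bigD1 (lift ord0 i)) //= US eqxx mul1r.
rewrite big1 ?addr0 => [|k /negPf]; last by rewrite US eq_sym => ->; rewrite mul0r.
by rewrite !mxE /cols /= -[bump 0 i]/i.+1 -[bump 0 j]/j.+1 entryE.
Qed.

(** * Backward differences of the values at negative integers *)

(* Sequences are extended by [u (-1) = 0], so that [bwd_diff] acts on generating
   functions as multiplication by [1 - z]. *)
Definition bwd_diff (R : realType) (u : nat -> R) (k : nat) : R :=
  if k is k'.+1 then u k - u k' else u k.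

Lemma iter_bwd_diffE (R : realType) (d : nat) (u : nat -> R) (s : nat) :
  iter d (@bwd_diff R) u s = \sum_(i < d.+1) alt_binom R d i * toeplitz u i s.
Proof.
elim: d u => [|d IHd] u.
  by rewrite big_ord1 /= /alt_binom bin0 /toeplitz subn0 expr0 !mul1r.
rewrite iterSr IHd (alt_binom_sumS d (fun i => toeplitz u i s)).
apply: eq_bigr => i _; congr (_ * _); rewrite /toeplitz.
case: (ltngtP i s) => [lt_is | lt_si | ->]; last by rewrite subnn subr0.
  by rewrite subnS; case: (s - i)%N (subn_gt0 i s) => //; rewrite lt_is.
by rewrite subr0.
Qed.

Lemma bwd_diff_ge0 (R : realType) (u : nat -> R) :
  (forall k, 0 <= bwd_diff u k) -> forall k, 0 <= u k.
Proof.
move=> du; elim=> [|k IHk]; first exact: (du 0%N).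
by have := du k.+1; rewrite /= subr_ge0; apply: le_trans.
Qed.

Lemma iter_bwd_diff_ge0 (R : realType) (d : nat) (u : nat -> R) :
  (forall k, 0 <= iter d (@bwd_diff R) u k) -> forall k, 0 <= u k.
Proof.
elim: d u => // d IHd u hu; apply: bwd_diff_ge0; apply: IHd => k.
by rewrite -iterSr.
Qed.

(* The complete alternating sum of [p] over [n + 2] consecutive integers vanishes,
   so the part over the nonnegative integers, which is nonnegative, is minus the
   part over the negative ones; the latter is the [(n + 1)]-st difference. *)
Lemma bwd_diff_signed_neg_ge0 (R : realType) (n : nat) (p : {poly R}) :
  size p = n.+1 -> totally_positive (fun k => p.[k%:R]) ->
  forall s, 0 <= bwd_diff (fun k => (-1) ^+ n * p.[- k.+1%:R]) s.
Proof.
move=> sz_p tp; set u := fun k : nat => _.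
apply: (@iter_bwd_diff_ge0 _ n) => s; rewrite -iterSr iter_bwd_diffE.
(* For s > n all n + 2 arguments are negative, no zero extension occurs, and the sum is a full
   difference. *)
have [le_sn | lt_ns] := leqP s n; last first.
  rewrite (eq_bigr (fun i : 'I_n.+2 => (-1) ^+ n *
      (alt_binom R n.+1 i * p.[- s.+1%:R + i%:R * 1]))) => [|i _]; last first.
    have le_is : (i <= s)%N by apply: leq_trans lt_ns; apply: leq_ord.
    rewrite /toeplitz le_is /u mulrCA; congr (_ * (_ * p.[_])).
    by rewrite -subSn // natrB ?leqW //; ring.
  by rewrite -mulr_sumr alt_binom_sum_horner ?sz_p ?mulr0.
have := toeplitz_fin_diff_ge0 (n - s) sz_p tp; set b := fun k : nat => _.
have full : \sum_(i < n.+2) alt_binom R n.+1 i * p.[(n - s)%:R + i%:R * -1] = 0.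
  by rewrite alt_binom_sum_horner ?sz_p.
rewrite -[X in 0 <= X]subr0 -[X in _ - X]full -sumrB.
congr (is_true (_ <= _)); rewrite (reindex_inj rev_ord_inj) /=.
apply: eq_bigr => i _; have := ltn_ord i; rewrite ltnS => le_i.
rewrite /alt_binom subSS bin_sub // /toeplitz.
have sgn : (-1) ^+ (n.+1 - i) = - ((-1) ^+ i * (-1) ^+ n) :> R.
  rewrite -signr_odd oddB // signr_addb !signr_odd exprS; ring.
(* After the reversal, i <= s are exactly the negative arguments -(s - i + 1); for i > s the two
   sums cancel termwise. *)
rewrite sgn; have [le_is | lt_si] := leqP i s.
  have -> : (n.+1 - i <= n - s)%N = false by lia.
  rewrite mulr0 sub0r /u.
  have -> : (n - s)%:R + (n.+1 - i)%:R * -1 = - (s - i).+1%:R :> R.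
    rewrite -subSn // !natrB //; last by lia.
    by rewrite -[n.+1%:R]natr1 -[s.+1%:R]natr1; ring.
  ring.
have le2 : (n.+1 - i <= n - s)%N by lia.
by rewrite le2 /b mulrN1 -natrB // subrr mulr0.
Qed.

(** * Binomial basis and 2 x 2 minors *)

Lemma size_binom_poly (R : realType) (k : nat) : size (binom_poly R k) = k.+1.
Proof.
rewrite size_scale ?invr_eq0 ?pnatr_eq0 -?lt0n ?fact_gt0 //.
by rewrite size_prod_XsubC [index_enum _]unlock -enumT size_enum_ord.
Qed.

Lemma horner_binom_poly (R : realType) (k : nat) (x : R) :
  (binom_poly R k).[x] = k`!%:R^-1 * \prod_(i < k) (x - i%:R).
Proof. by rewrite hornerZ horner_prod; under eq_bigr do rewrite !hornerE. Qed.

(** Both sides equal (-1)^k C(m + k, k). *)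
Lemma binom_poly_at_neg (R : realType) (m k : nat) :
  (binom_poly R k).[- m.+1%:R] = m`!%:R^-1 * (('X^m * 'X^k)^`(m)).[-1].
Proof.
have fact_neq0 j : j`!%:R != 0 :> R by rewrite pnatr_eq0 -lt0n fact_gt0.
rewrite horner_binom_poly -exprD derivnXn addKn hornerMn hornerXn -mulr_natr.
have ffactE : (m + k)`!%:R = ((m + k) ^_ m)%:R * k`!%:R :> R.
  by rewrite -natrM -(ffact_fact (leq_addr k m)) addKn.
have prodE : m`!%:R * \prod_(i < k) (- m.+1%:R - i%:R) =
    (-1) ^+ k * (m + k)`!%:R :> R.
  elim: (k) => [|j IHj]; first by rewrite big_ord0 addn0 mulr1 mul1r.
  rewrite big_ord_recr /= mulrA IHj addnS factS natrM -addSn natrD exprS; ring.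
apply: (mulfI (fact_neq0 m)); rewrite mulrCA prodE ffactE.
by field; rewrite !fact_neq0.
Qed.

(** With b_k = 0, the minor on rows 0, k - j and columns k, i equals -b_i b_j. *)
Lemma totally_positive_zero_tail (R : realType) (b : nat -> R) (j k i : nat) :
  totally_positive b -> (j < k)%N -> (k <= i)%N -> b k = 0 -> b j != 0 -> b i = 0.
Proof.
move=> [b_ge0 tp] lt_jk le_ki bk bj.
have [-> // | lt_ki] := eqVneq i k; have {}lt_ki : (k < i)%N by lia.
pose rows (x : 'I_2) : nat := if x == ord0 then 0%N else (k - j)%N.
pose cols (x : 'I_2) : nat := if x == ord0 then k else i.
have homo2 (f : 'I_2 -> nat) : (f ord0 < f (lift ord0 ord0))%N ->
    {homo f : x y / (x < y)%N}.
  move=> lt_f x y.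
  case: (unliftP ord0 x) => [x' | ] ->; case: (unliftP ord0 y) => [y' | ] -> //.
    by rewrite !ord1 ltnn.
  by rewrite ord1.
have /homo2 homo_rows : (rows ord0 < rows (lift ord0 ord0))%N by rewrite /rows /= subn_gt0.
have /homo2 homo_cols : (cols ord0 < cols (lift ord0 ord0))%N by [].
have := tp 2%N rows cols homo_rows homo_cols.
rewrite /toeplitz_minor (expand_det_row _ ord0) !big_ord_recl big_ord0 addr0.
rewrite /cofactor !det_mx11 !mxE /rows /cols /= /toeplitz /= !subn0.
rewrite leq_subr (subKn (ltnW lt_jk)) bk mul0r add0r expr1 mulN1r mulrN oppr_ge0 => le0.
have : b i * b j == 0 by rewrite eq_le le0 mulr_ge0.
by rewrite mulf_eq0 (negPf bj) orbF => /eqP.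
Qed.

Theorem theorem3p2 (R : realType) (n : nat) (a : 'I_n.+1 -> R) (P Q : {poly R})
    (n_ge1 : (1 <= n)%N)
    (an1 : a ord_max = 1)
    (defP : P = \sum_(k < n.+1) a k *: binom_poly R k)
    (defQ : Q = \sum_(k < n.+1) a k *: 'X^k)
    (tpP : totally_positive (fun k : nat => P.[k%:R])) :
  [/\ forall k : nat, (1 <= k <= n - 1)%N -> P.[k%:R] = 0 ->
        forall j : nat, (j <= k - 1)%N -> P.[j%:R] = 0,
      forall m : nat, (1 <= m)%N ->
        P.[- m%:R] = ((m - 1)`!%:R)^-1 * (('X^(m - 1) * Q)^`(m - 1)).[-1],
      forall l : nat, (1 <= l)%N -> P.[- l%:R] = 0 ->
        forall j : nat, (1 <= j <= l - 1)%N -> P.[- j%:R] = 0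
    & forall l : nat, size P = (2 * l + 1).+1 ->
        exists x : R, -1 <= x <= 0 /\ root P x].
Proof.
have coefN : P`_n != 0.
  rewrite defP coef_sum big_ord_recr /= big1 ?add0r => [|k _]; last first.
    by rewrite coefZ nth_default ?mulr0 // size_binom_poly.
  rewrite an1 scale1r -[X in _`_X]/(n.+1.-1) -(size_binom_poly R n) -lead_coefE.
  by rewrite lead_coef_eq0 -size_poly_eq0 size_binom_poly.
have sz_P : size P = n.+1.
  apply/eqP; rewrite eqn_leq; apply/andP; split; last first.
    by rewrite ltnNge; apply: contra coefN => le_P; rewrite nth_default.
  rewrite defP (leq_trans (size_sum _ _ _)) //; apply/bigmax_leqP => k _.
  by rewrite (leq_trans (size_scale_leq _ _)) // size_binom_poly.
(* Index k stands for the argument -(k + 1), so [u] starts at P(-1). *)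
pose u k : R := (-1) ^+ n * P.[- k.+1%:R].
have du_ge0 s : 0 <= bwd_diff u s by apply: bwd_diff_signed_neg_ge0.
have u_ge0 : forall k, 0 <= u k by apply: bwd_diff_ge0.
have u_homo : {homo u : i j / (i <= j)%N >-> i <= j}.
  apply: homo_leq => [//|y x z|k]; first exact: le_trans.
  by have := du_ge0 k.+1; rewrite /= subr_ge0.
have u_eq0 k : (u k == 0) = (P.[- k.+1%:R] == 0) by rewrite mulf_eq0 signr_eq0.
split.
- move=> k /andP[k_gt0 le_kn] Pk0 j le_jk; apply/eqP; apply: contraT => Pj.
  have P0 i : (k <= i)%N -> P.[i%:R] = 0.
    move=> le_ki; apply: (totally_positive_zero_tail tpP _ le_ki Pk0 Pj).
    by lia.
  (* The n + 1 roots k, ..., k + n are too many for degree n. *)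
  pose rs := [seq i%:R | i <- iota k n.+1] : seq R.
  have uniq_rs : uniq rs.
    by rewrite map_inj_uniq ?iota_uniq // => x y /(mulrIn (oner_neq0 R)).
  have root_rs : all (root P) rs.
    apply/allP => x /mapP[i + ->]; rewrite mem_iota => /andP[le_ki _].
    by apply/rootP/P0.
  have P_neq0 : P != 0 by rewrite -size_poly_eq0 sz_P.
  have := max_poly_roots P_neq0 root_rs uniq_rs.
  by rewrite size_map size_iota sz_P ltnn.
- case=> // m _; rewrite subn1 /= defP defQ horner_sum mulr_sumr raddf_sum /=.
  rewrite horner_sum mulr_sumr; apply: eq_bigr => k _.
  by rewrite hornerZ binom_poly_at_neg -scalerAr derivnZ hornerZ mulrCA.
- case=> // l _ Pl0 [//|j]; rewrite subn1 /= => lt_jl.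
  apply/eqP; rewrite -u_eq0 eq_le u_ge0 andbT.
  have /eqP <- : u l == 0 by rewrite u_eq0 Pl0.
  by apply: u_homo; apply: ltnW.
- move=> l; rewrite sz_P => -[n_eq].
  have odd_n : odd n by rewrite n_eq oddD oddM.
  have Pm1 : P.[-1] <= 0.
    by have := u_ge0 0%N; rewrite /u -signr_odd odd_n mulN1r oppr_ge0.
  have P0 : 0 <= P.[0] by case: tpP => /(_ 0%N).
  have [|x xI Px] := @poly_ivt R P (-1) 0 (lerN10 R); first by rewrite Pm1 P0.
  by exists x.
Qed.
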